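(* Let $M\geq2$ be an integer, and let $\rho>0$ and $\alpha>0$ be real numbers. For $X$ with values in $\{1,\ldots,M\}$ and $Y$ an arbitrary random variable, as $\Delta H_\alpha(X;Y)\to0$, up to first order, $$\Delta G_\rho(X;Y)\lesssim\sqrt{\frac{2\,(G_{2\rho}(M)-G_\rho^2(M))}{\alpha}}\;\sqrt{\frac{\Delta H_\alpha(X;Y)}{\log e}}.$$ In particular (case $\rho=1$, with $\Delta G=\Delta G_1$), $\Delta G(X;Y)\lesssim\sqrt{\frac{M^2-1}{6\alpha}}\;\sqrt{\frac{\Delta H_\alpha(X;Y)}{\log e}}$. Here ''$\Delta G_\rho\lesssim c\sqrt{\Delta H_\alpha/\log e}$ up to first order as $\Delta H_\alpha\to0$'' means: for fixed $M,\rho,\alpha$ and every $\varepsilon>0$ there is $\delta>0$ such that every pair $(X,Y)$ with $\Delta H_\alpha(X;Y)\leq\delta$ satisfies $\Delta G_\rho(X;Y)\leq(c+\varepsilon)\sqrt{\Delta H_\alpha(X;Y)/\log e}$.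
   Context: $\log$ is the logarithm to an arbitrary fixed base greater than $1$; $e$ is Euler's number. For $X$ with values in $\{1,\ldots,M\}$ and pmf $p_X$, the $\rho$-guessing entropy is $G_\rho(X)=\min_\sigma\sum_{i=1}^M p_X(\sigma(i))\,i^\rho$, the minimum being over all permutations $\sigma$ of $\{1,\ldots,M\}$. For an arbitrary (discrete or continuous) random variable $Y$, with $p_{X|Y=y}$ the conditional pmf of $X$ given $Y=y$, $G_\rho(X|Y)=\mathbb{E}_y G_\rho(X|Y=y)$, where $G_\rho(X|Y=y)$ is the $\rho$-guessing entropy of $p_{X|Y=y}$. For $\alpha\neq1$, the conditional R\'enyi-Arimoto entropy is $H_\alpha(X|Y)=-\frac{\alpha}{\alpha-1}\log\mathbb{E}_Y\|p_{X|Y}\|_\alpha$ with $\|p\|_\alpha=(\sum_i p(i)^\alpha)^{1/\alpha}$; for $\alpha=1$, $H_1(X|Y)=H(X|Y)$ is the conditional Shannon entropy $\mathbb{E}_y\bigl[-\sum_i p_{X|Y=y}(i)\log p_{X|Y=y}(i)\bigr]$. For $s>0$, $G_s(M)=\frac1M\sum_{i=1}^M i^s$. The guessing advantage is $\Delta G_\rho(X;Y)=G_\rho(M)-G_\rho(X|Y)$, and the information advantage is $\Delta H_\alpha(X;Y)=\log M-H_\alpha(X|Y)$. *)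

(* Defs.v *)
From HB Require Import structures.
From mathcomp Require Import all_boot all_order all_algebra fingroup perm.
From mathcomp Require Import all_classical all_reals all_analysis.

Set Implicit Arguments.
Unset Strict Implicit.
Unset Printing Implicit Defensive.

Import Order.TTheory GRing.Theory Num.Theory.
Import numFieldNormedType.Exports.

Local Open Scope classical_set_scope.
Local Open Scope ring_scope.

(* The value set {1, ..., M} is 'I_M, with i : 'I_M standing for i.+1. *)

Definition logb (R : realType) (b x : R) : R := ln x / ln b.

Section pmf.
Variables (R : realType) (M : nat).
Implicit Type p : 'I_M -> R.

Definition is_pmf p : Prop := (forall i, 0 <= p i) /\ \sum_i p i = 1.

Definition guess_moment (rho : R) p (s : 'S_M) : R :=
  \sum_(i < M) p (s i) * (i.+1%:R `^ rho).

(* The default value of the iterated minimum is itself the moment of a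
   permutation, hence this is the minimum over 'S_M. *)
Definition guessing_entropy (rho : R) p : R :=
  \big[Order.min/guess_moment rho p 1%g]_(s : 'S_M) guess_moment rho p s.

Definition alpha_norm (alpha : R) p : R :=
  (\sum_(i < M) p i `^ alpha) `^ alpha^-1.

(* ln 0 = 0, so that 0 log 0 = 0. *)
Definition shannon_entropy (b : R) p : R := - \sum_(i < M) p i * logb b (p i).

End pmf.

Definition uniform_guessing (R : realType) (s : R) (M : nat) : R :=
  M%:R^-1 * \sum_(i < M) i.+1%:R `^ s.

Section conditional.
Context (d d' : measure_display) (Omega : measurableType d)
  (T : measurableType d') (R : realType) (P : probability Omega R) (M : nat).

(* 'I_M may be empty and thus has no canonical measurableType structure: this
   is measurability of X for the discrete sigma-algebra on 'I_M. *)
Definition discrete_measurable_fun (X : Omega -> 'I_M) : Prop :=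
  forall i, measurable (X @^-1` [set i]).

(* p y is (a version of) the conditional pmf of X given Y = y, for Y with
   values in an arbitrary measurable space. *)
Definition cond_pmf (X : Omega -> 'I_M) (Y : {RV P >-> T})
    (p : T -> 'I_M -> R) : Prop :=
  [/\ forall i, measurable_fun [set: T] (fun y => p y i),
      forall y, is_pmf (p y)
    & forall i (B : set T), measurable B ->
        P (X @^-1` [set i] `&` Y @^-1` B) =
        (\int[distribution P Y]_(y in B) (p y i)%:E)%E].

Variables (Y : {RV P >-> T}) (p : T -> 'I_M -> R).

Definition Ey (f : T -> R) : R := fine ('E_(distribution P Y)[f])%E.

Definition cond_guessing_entropy (rho : R) : R :=
  Ey (fun y => guessing_entropy rho (p y)).

Definition cond_renyi_arimoto (b alpha : R) : R :=
  if alpha == 1 then Ey (fun y => shannon_entropy b (p y))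
  else - (alpha / (alpha - 1)) * logb b (Ey (fun y => alpha_norm alpha (p y))).

Definition guessing_advantage (rho : R) : R :=
  uniform_guessing rho M - cond_guessing_entropy rho.

Definition information_advantage (b alpha : R) : R :=
  logb b M%:R - cond_renyi_arimoto b alpha.

End conditional.

(* DeltaG_rho(X;Y) <~ c sqrt(DeltaH_alpha(X;Y) / log e) up to first order as
   DeltaH_alpha(X;Y) -> 0. The threshold delta is uniform over all probability
   spaces, all pairs (X, Y) and all versions p of the conditional pmf. *)
Definition first_order_bound (R : realType) (b : R) (M : nat)
    (rho alpha c : R) : Prop :=
  forall eps : R, 0 < eps -> exists2 delta : R, 0 < delta &
  forall (d d' : measure_display) (Omega : measurableType d)
    (T : measurableType d') (P : probability Omega R)
    (X : Omega -> 'I_M) (Y : {RV P >-> T}) (p : T -> 'I_M -> R),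
  discrete_measurable_fun X -> cond_pmf X Y p ->
  information_advantage Y p b alpha <= delta ->
  guessing_advantage Y p rho <=
    (c + eps) *
    Num.sqrt (information_advantage Y p b alpha / logb b (expR 1)).

(* Main.v *)
(* Write u_i = M p_i for a pmf p on M points. By AM-GM, the guessing gap
   G_rho(M) - G_rho(p) is at most t/2 * mean (u_i - 1)^2 + V / (2t) for every
   t > 0, where V = G_{2rho}(M) - G_rho(M)^2. Near the uniform pmf,
   alpha/2 * mean (u_i - 1)^2 is equivalent to the divergence
   D(p) = alpha/(alpha-1) * (||p||_alpha / ||uniform||_alpha - 1) (relative
   entropy if alpha = 1), which is bounded below away from it. Hence, for k > 1,
     gap(p) <= (t k^2 / alpha + C) * D(p) + V / (2t)
   for all p and t. This is linear in D, so it can be integrated over Y, and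
   E D(p_Y) is at most k times the information advantage in nats once the latter
   is small. Optimizing over t gives the square root; the term in C is of
   higher order. *)

Require Import Defs.
From mathcomp Require Import all_boot all_order all_algebra fingroup perm.
From mathcomp Require Import all_classical all_reals all_analysis.
From mathcomp Require Import measurable_realfun ring lra.

Set Implicit Arguments.
Unset Strict Implicit.
Unset Printing Implicit Defensive.

Import Order.TTheory GRing.Theory Num.Theory.
Import numFieldNormedType.Exports.

Local Open Scope classical_set_scope.
Local Open Scope ring_scope.

(** * Calculus of a convex function comparing a density value with 1, and of the passage from the
    Tsallis to the Arimoto scale *)

Section calculus.
Variable R : realType.
Implicit Types (a b c u z k alpha : R) (f df F : R -> R).

(** The difference quotient tends to [c], hence exceeds [c / k] near [a]; multiplying by
    [(u - a) ^+ 2] gives a form valid on both sides of [a]. *)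
Lemma is_derive_local F a c k : is_derive a 1 F c -> F a = 0 -> 0 < c -> 1 < k ->
  exists2 eta : R, 0 < eta & forall u, `|u - a| <= eta ->
    c * (u - a) ^+ 2 <= k * ((u - a) * F u).
Proof.
move=> [dF Fc] Fa c0 k1.
have k0 : 0 < k by lra.
have : (fun h => h^-1 *: (F (h + a) - F a)) @ 0^' --> c.
  move: dF Fc; rewrite /derivable /derive => dF <-.
  have -> : (fun h : R => h^-1 *: (F (h + a) - F a)) =
            (fun h : R => h^-1 *: ((F \o shift a) (h *: (1 : R)) - F a)).
    by apply/funext => h /=; rewrite /GRing.scale/= mulr1.
  exact: dF.
have ck : c / k < c by rewrite ltr_pdivrMr// ltr_pMr.
move=> /cvgr_gt /(_ _ ck) [e /= e0 He].
exists (e / 2); first lra.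
move=> u ue; have [->|ua] := eqVneq u a.
  by rewrite subrr expr2 !mul0r !mulr0.
have ua0 : u - a != 0 by rewrite subr_eq0.
have := He (u - a); rewrite /ball_/= sub0r normrN => /(_ _ ua0).
have -> : `|u - a| < e by lra.
move=> /(_ isT); rewrite subrK Fa subr0 /GRing.scale/= ltr_pdivrMr// => h.
have : c * (u - a) ^+ 2 <= ((u - a)^-1 * F u * k) * (u - a) ^+ 2.
  by rewrite ler_wpM2r// ?sqr_ge0// ltW.
suff -> : (u - a)^-1 * F u * k * (u - a) ^+ 2 = k * ((u - a) * F u) by [].
by field.
Qed.

Lemma le_of_derive_ge0 f df a b : 0 < a -> a <= b ->
  (forall x : R, 0 < x -> is_derive x 1 f (df x)) ->
  (forall x : R, a < x < b -> 0 <= df x) -> f a <= f b.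
Proof.
move=> a0 ab fdf df0.
have ifdf x : x \in `]a, b[%R -> is_derive x 1 f (df x).
  by rewrite in_itv/= => /andP[ax _]; apply: fdf; lra.
have cf : {within `[a, b], continuous f}.
  apply: derivable_within_continuous => x /[!in_itv]/= /andP[ax _].
  by apply: ex_derive; apply: fdf; lra.
move: ab; rewrite le_eqVlt => /predU1P[->//|ab].
have [x /[!in_itv]/= xab e] := MVT ab ifdf cf.
by rewrite -subr_ge0 e mulr_ge0 ?df0// subr_ge0 ltW.
Qed.

Lemma le_of_derive_le0 f df a b : 0 < a -> a <= b ->
  (forall x : R, 0 < x -> is_derive x 1 f (df x)) ->
  (forall x : R, a < x < b -> df x <= 0) -> f b <= f a.
Proof.
move=> a0 ab fdf df0; rewrite -lerN2.
apply: (@le_of_derive_ge0 (- f) (fun x => - df x)) => // [x x0|x xab].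
  by have := fdf x x0 => ?; exact: is_deriveN.
by rewrite oppr_ge0 df0.
Qed.

(** Bregman divergence of [u] from 1 generated by [u ln u], or by [u ^ alpha / (alpha - 1)]. The
    affine terms make value and slope vanish at 1 and average to a constant over a density. *)
Definition bregman alpha u : R :=
  if alpha == 1 then u * ln u - u + 1
  else (u `^ alpha - alpha * u + alpha - 1) / (alpha - 1).

Definition bregman' alpha u : R :=
  alpha * (if alpha == 1 then ln u else (u `^ (alpha - 1) - 1) / (alpha - 1)).

Lemma is_derive_bregman alpha u : 0 < u ->
  is_derive u 1 (bregman alpha) (bregman' alpha u).
Proof.
move=> u0; rewrite /bregman /bregman'; case: eqVneq => [->|a1].
  have -> : (fun u : R => u * ln u - u + 1) = (id * (@ln R) - id + cst 1)%R.
    by apply/funext.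
  have dl := is_derive1_ln u0.
  apply: is_derive_eq; rewrite /GRing.scale/=.
  field.
  by rewrite gt_eqF.
have -> : (fun u : R => (u `^ alpha - alpha * u + alpha - 1) / (alpha - 1)) =
    ((alpha - 1)^-1 \*: ((@powR R ^~ alpha) - alpha \*: id + cst (alpha - 1)))%R.
  apply/funext => v.
  rewrite [RHS]/((alpha - 1)^-1 * (v `^ alpha - alpha * v + (alpha - 1))).
  by rewrite [LHS]mulrC addrA.
have dp := is_derive1_powR alpha u0.
apply: is_derive_eq; rewrite /GRing.scale/=.
by field; rewrite subr_eq0.
Qed.

Lemma is_derive_bregman' alpha : is_derive (1 : R) 1 (bregman' alpha) alpha.
Proof.
rewrite /bregman'; case: eqVneq => [->|a1].
  have -> : (fun u : R => 1 * ln u) = @ln R by apply/funext => v; rewrite mul1r.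
  by have := is_derive1_ln (@ltr01 R); rewrite invr1.
have -> : (fun u : R => alpha * ((u `^ (alpha - 1) - 1) / (alpha - 1))) =
    ((alpha / (alpha - 1)) \*: ((@powR R ^~ (alpha - 1)) - cst 1))%R.
  apply/funext => v.
  rewrite [RHS]/((alpha / (alpha - 1)) * (v `^ (alpha - 1) - 1)).
  by rewrite -[RHS]mulrA [in RHS](mulrC _^-1).
have dp := is_derive1_powR (alpha - 1) (@ltr01 R).
apply: is_derive_eq; rewrite /GRing.scale/= powR1.
by field; rewrite subr_eq0.
Qed.

Lemma bregman'1 alpha : bregman' alpha 1 = 0.
Proof. by rewrite /bregman' ln1 powR1 subrr mul0r; case: ifP; rewrite mulr0. Qed.

Lemma bregman1 alpha : bregman alpha 1 = 0.
Proof.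
rewrite /bregman ln1 powR1; case: ifP => _; first by ring.
by rewrite (_ : _ - 1 = 0) ?mul0r//; ring.
Qed.

Lemma bregman0 alpha : 0 < alpha -> bregman alpha 0 = 1.
Proof.
move=> a0; rewrite /bregman; case: eqVneq => [_|a1]; first by ring.
rewrite powR0 ?gt_eqF//; field.
by rewrite subr_eq0.
Qed.

(** [u - 1] and [ln u] have the same sign, and [u ^ (alpha - 1) - 1] has that of
    [(alpha - 1) * ln u]. Thus [bregman alpha] falls before 1 and rises after it. *)
Lemma bregman'_sign alpha u : 0 < alpha -> 0 < u ->
  0 <= (u - 1) * bregman' alpha u.
Proof.
move=> a0 u0; rewrite /bregman' mulrCA mulr_ge0 ?(ltW a0)//.
have ln_sign v : 0 < v -> 0 <= (v - 1) * ln v.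
  move=> v0; case: (leP 1 v) => v1.
    by rewrite mulr_ge0 ?ln_ge0// subr_ge0.
  by rewrite mulr_le0 ?ln_le0 ?subr_le0// ltW.
case: eqVneq => [_|a1]; first exact: ln_sign.
have e : (u - 1) * ((u `^ (alpha - 1) - 1) / (alpha - 1)) =
   ((alpha - 1) * (u - 1) * (u `^ (alpha - 1) - 1)) / (alpha - 1) ^+ 2.
  by field; rewrite subr_eq0.
rewrite e divr_ge0 ?sqr_ge0//.
have [->|u1] := eqVneq u 1; first by rewrite subrr mulr0 mul0r.
have lu : ln u != 0 by rewrite ln_eq0.
rewrite /powR gt_eqF//; set E := expR _ - 1.
have hE : 0 <= ((alpha - 1) * ln u) * E.
  rewrite /E; case: (leP 0 ((alpha - 1) * ln u)) => v0.
    by rewrite mulr_ge0// subr_ge0 leNgt expR_lt1 -leNgt.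
  by rewrite mulr_le0// ?subr_le0 ?expR_le1 ltW.
(* The factor [ln u ^+ 2] supplies one [ln u] to each of the two sign-matched pairs. *)
rewrite -(pmulr_rge0 _ (_ : 0 < ln u ^+ 2)) ?exprn_even_gt0//.
suff -> : ln u ^+ 2 * ((alpha - 1) * (u - 1) * E) =
  ((alpha - 1) * ln u * E) * ((u - 1) * ln u) by rewrite mulr_ge0// ln_sign.
by ring.
Qed.

(** The second derivative at 1 is [alpha], which gives the quadratic bound within distance [eta] of
    1; farther out, monotonicity on each side keeps the value above those at [1 - eta] and
    [1 + eta]. *)
Lemma bregman_dichotomy alpha k : 0 < alpha -> 1 < k ->
  exists2 m : R, 0 < m & forall u, 0 <= u ->
    alpha / 2 * (u - 1) ^+ 2 <= k * bregman alpha u \/ m <= bregman alpha u.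
Proof.
move=> a0 k1; have k0 : 0 < k by lra.
have [eta' eta'0 loc'] :=
  is_derive_local (is_derive_bregman' alpha) (bregman'1 alpha) a0 k1.
(* Capping [eta] at 1/2 keeps [1 - eta] positive, inside the domain where the derivative is
   known. *)
pose eta := Num.min eta' (1 / 2).
have eta0 : 0 < eta by rewrite lt_min eta'0/=; lra.
have eta1 : eta <= 1 / 2 by rewrite ge_min lexx orbT.
have {loc'}loc u : `|u - 1| <= eta ->
    alpha * (u - 1) ^+ 2 <= k * ((u - 1) * bregman' alpha u).
  by move=> h; apply: loc'; rewrite (le_trans h)// ge_min lexx.
(* [h] vanishes at 1 and [h'] has the sign of [u - 1] near 1, so [h] is nonnegative there. *)
pose h u := k * bregman alpha u - alpha / 2 * (u - 1) ^+ 2.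
pose h' u := k * bregman' alpha u - alpha * (u - 1).
have dh u : 0 < u -> is_derive u 1 h (h' u).
  move=> u0; have db := is_derive_bregman alpha u0.
  have -> : h = (k \*: bregman alpha - (alpha / 2) \*: (id - cst 1) ^+ 2)%R.
    by apply/funext.
  by apply: is_derive_eq; rewrite /h' /GRing.scale/= !fctE/=; lra.
have h1 : h 1 = 0 by rewrite /h bregman1 subrr expr2 !(mul0r, mulr0) subrr.
have h'_sign u : `|u - 1| <= eta -> 0 <= (u - 1) * h' u.
  by move=> /loc; rewrite /h' -subr_ge0 => l; rewrite mulrBr; nra.
have hge u : `|u - 1| <= eta -> 0 <= h u.
  rewrite -h1 ler_distl => /andP[u1 u2]; have [ul|ul] := leP 1 u.
    apply: (@le_of_derive_ge0 h h') => // x /andP[x1 x2].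
    rewrite -(pmulr_rge0 _ (_ : 0 < x - 1)) ?subr_gt0// h'_sign//.
    by rewrite gtr0_norm ?subr_gt0//; lra.
  apply: (@le_of_derive_le0 h h') => //; [lra|exact: ltW|move=> x /andP[x1 x2]].
  rewrite -(nmulr_rge0 _ (_ : x - 1 < 0)) ?subr_lt0// h'_sign//.
  by rewrite ltr0_norm ?subr_lt0//; lra.
have reta : alpha / 2 * eta ^+ 2 / k <= bregman alpha (1 + eta).
  have := hge (1 + eta); rewrite /h addrC addKr ger0_norm ?lexx ?(ltW eta0)//.
  by move=> /(_ isT); rewrite subr_ge0 ler_pdivrMr// mulrC [_ * k]mulrC.
have leta : alpha / 2 * eta ^+ 2 / k <= bregman alpha (1 - eta).
  have := hge (1 - eta); rewrite /h addrAC subrr sub0r normrN sqrrN.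
  rewrite gtr0_norm// lexx => /(_ isT).
  by rewrite subr_ge0 ler_pdivrMr// mulrC [_ * k]mulrC.
(* The 1 is the value of [bregman alpha] at 0, a point that the derivative arguments do not
   reach. *)
exists (Num.min 1 (alpha / 2 * eta ^+ 2 / k)).
  by rewrite lt_min ltr01 !(divr_gt0, mulr_gt0, exprn_gt0).
move=> u; rewrite le_eqVlt => /predU1P[<-|u0].
  by right; rewrite bregman0// ge_min lexx.
have [ue|ue] := leP `|u - 1| eta.
  by left; rewrite -subr_ge0 hge.
right; rewrite ge_min; apply/orP; right.
have [u1|u1] := leP 1 u.
  apply: (le_trans reta).
  apply: (@le_of_derive_ge0 (bregman alpha) (bregman' alpha)); first lra.
  - by move: ue; rewrite ger0_norm; lra.
  - by move=> x; exact: is_derive_bregman.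
  - move=> x /andP[x1 x2]; rewrite -(pmulr_rge0 _ (_ : 0 < x - 1)) ?bregman'_sign//; lra.
apply: (le_trans leta).
apply: (@le_of_derive_le0 (bregman alpha) (bregman' alpha)) => //.
- by move: ue; rewrite ltr0_norm; lra.
- by move=> x; exact: is_derive_bregman.
- move=> x /andP[x1 x2]; rewrite -(nmulr_rge0 _ (_ : x - 1 < 0)) ?bregman'_sign//; lra.
Qed.

(* If z is the Tsallis divergence of p from uniform, 1 + (alpha - 1) z is the
   mean of (M p_i)^alpha; its power 1 / alpha is the normalized alpha-norm. *)
Definition arimoto_of_tsallis alpha z : R :=
  if alpha == 1 then z
  else alpha / (alpha - 1) * ((1 + (alpha - 1) * z) `^ alpha^-1 - 1).

Lemma is_derive_arimoto_of_tsallis alpha : 0 < alpha ->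
  is_derive (0 : R) 1 (arimoto_of_tsallis alpha) 1.
Proof.
move=> a0; rewrite /arimoto_of_tsallis; case: eqVneq => [_|a1].
  exact: is_derive_id.
pose g z : R := 1 + (alpha - 1) * z.
have dg : is_derive (0 : R) 1 g (alpha - 1).
  have -> : g = (cst 1 + (alpha - 1) \*: id)%R by apply/funext.
  by apply: is_derive_eq; rewrite add0r /GRing.scale/= mulr1.
have g0 : 0 < g 0 by rewrite /g mulr0 addr0.
have dp := is_derive1_powR alpha^-1 g0.
have dpg := @is_derive1_comp R (@powR R ^~ alpha^-1) g 0 _ _ dp dg.
have -> : (fun z : R => alpha / (alpha - 1) *
      ((1 + (alpha - 1) * z) `^ alpha^-1 - 1)) =
    ((alpha / (alpha - 1)) \*: ((@powR R ^~ alpha^-1) \o g - cst 1))%R.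
  by apply/funext.
apply: is_derive_eq; rewrite /GRing.scale/= /g mulr0 addr0 powR1.
by field; rewrite subr_eq0 a1 gt_eqF.
Qed.

(** For [alpha < 1] the outer factor and the inner slope are both negative, so the two reversals
    cancel. *)
Lemma arimoto_of_tsallis_homo alpha z z' : 0 < alpha ->
  0 <= 1 + (alpha - 1) * z -> 0 <= 1 + (alpha - 1) * z' -> z <= z' ->
  arimoto_of_tsallis alpha z <= arimoto_of_tsallis alpha z'.
Proof.
move=> a0 z0 z'0 zz'; rewrite /arimoto_of_tsallis; case: eqVneq => // a1.
have ai : 0 <= alpha^-1 by rewrite invr_ge0 ltW.
have [al1|al1] : alpha - 1 < 0 \/ 0 < alpha - 1.
  by move/eqP : a1 => a1; have [|] := ltP (alpha - 1) 0; [left|right; lra].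
- rewrite ler_wnM2l//; first by rewrite mulr_ge0_le0 ?(ltW a0)// invr_le0 ltW.
  rewrite lerD2r ge0_ler_powR ?nnegrE//.
  by rewrite lerD2l ler_nM2l.
- rewrite ler_wpM2l//; first by rewrite divr_ge0// ltW.
  by rewrite lerD2r ge0_ler_powR ?nnegrE// lerD2l ler_pM2l.
Qed.

(** Slope 1 at 0 settles small [z]; at larger [z], monotonicity bounds the value below by the one at
    [eta]. *)
Lemma arimoto_of_tsallis_dichotomy alpha k : 0 < alpha -> 1 < k ->
  exists2 m : R, 0 < m & forall z, 0 <= z -> 0 <= 1 + (alpha - 1) * z ->
    z <= k * arimoto_of_tsallis alpha z \/ m <= arimoto_of_tsallis alpha z.
Proof.
move=> a0 k1; have k0 : 0 < k by lra.
have psi0 : arimoto_of_tsallis alpha 0 = 0.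
  by rewrite /arimoto_of_tsallis mulr0 addr0 powR1 subrr mulr0; case: ifP.
have [eta eta0 loc] :=
  is_derive_local (is_derive_arimoto_of_tsallis a0) psi0 ltr01 k1.
have {}loc z : 0 < z <= eta -> z <= k * arimoto_of_tsallis alpha z.
  move=> /andP[z0 zeta]; have := loc z; rewrite subr0 gtr0_norm// => /(_ zeta).
  by rewrite mul1r mulrCA expr2 ler_pM2l.
exists (eta / k); first exact: divr_gt0.
move=> z; rewrite le_eqVlt => /predU1P[<-|z0] hz.
  by left; rewrite psi0 mulr0.
have [ze|ze] := leP z eta; first by left; apply: loc; rewrite z0.
right; apply: (@le_trans _ _ (arimoto_of_tsallis alpha eta)).
  by rewrite ler_pdivrMr// mulrC loc// eta0 lexx.
apply: arimoto_of_tsallis_homo => //; last exact: ltW.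
(* Nonnegativity of [1 + (alpha - 1) * eta]: the affine expression is nonnegative at 0 and at [z],
   and [eta] lies between. *)
nra.
Qed.

End calculus.

(** * Divergences of a pmf from uniform, and the pointwise bound on the guessing gap *)

Section divergence.
Variables (R : realType) (M : nat).
Hypothesis M0 : (0 < M)%N.
Implicit Types (p : 'I_M -> R) (alpha rho k t b : R).

Let MR0 : 0 < M%:R :> R.
Proof. by rewrite ltr0n. Qed.

Let MR_neq0 : M%:R != 0 :> R.
Proof. by rewrite gt_eqF. Qed.

Definition mean (f : 'I_M -> R) : R := M%:R^-1 * \sum_i f i.

Lemma mean_cst a : mean (fun=> a) = a.
Proof.
by rewrite /mean sumr_const card_ord -[a *+ M]mulr_natl mulKf.
Qed.

Lemma meanD f g : mean (fun i => f i + g i) = mean f + mean g.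
Proof. by rewrite /mean big_split mulrDr. Qed.

Lemma meanZ a f : mean (fun i => a * f i) = a * mean f.
Proof. by rewrite /mean -mulr_sumr mulrCA. Qed.

Lemma ler_mean f g : (forall i, f i <= g i) -> mean f <= mean g.
Proof.
by move=> fg; rewrite /mean ler_wpM2l ?invr_ge0 ?(ltW MR0)// ler_sum.
Qed.

Lemma mean_ge0 f : (forall i, 0 <= f i) -> 0 <= mean f.
Proof. by move=> f0; rewrite -(mean_cst 0) ler_mean. Qed.

Lemma mean_ge_term f i : (forall i, 0 <= f i) -> M%:R^-1 * f i <= mean f.
Proof.
move=> f0; rewrite /mean ler_wpM2l ?invr_ge0 ?(ltW MR0)// (bigD1 i)//= lerDl.
by rewrite sumr_ge0.
Qed.

Lemma mean_density p : is_pmf p -> mean (fun i => M%:R * p i) = 1.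
Proof. by move=> [_ p1]; rewrite meanZ /mean p1 mulr1 mulfV. Qed.

Definition chi2 p : R := mean (fun i => (M%:R * p i - 1) ^+ 2).

Definition tsallis alpha p : R := mean (fun i => bregman alpha (M%:R * p i)).

(** On pmfs, relative entropy in nats for [alpha = 1]; otherwise affine in [alpha_norm alpha p], so
    that its average over [Y] only sees the average norm. *)
Definition arimoto alpha p : R := arimoto_of_tsallis alpha (tsallis alpha p).

Lemma bregman_ge0 alpha u : 0 < alpha -> 0 <= u -> 0 <= bregman alpha u.
Proof.
have lt12 : 1 < 2 :> R by rewrite ltr1n.
move=> a0 u0; have [m m0 /(_ u u0)[h|h]] := bregman_dichotomy a0 lt12.
  rewrite -(@pmulr_rge0 _ 2)// (le_trans _ h)//.
  by rewrite mulr_ge0 ?sqr_ge0// divr_ge0 ?(ltW a0).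
by rewrite (le_trans _ h)// ltW.
Qed.

Lemma density_ge0 p i : is_pmf p -> 0 <= M%:R * p i.
Proof. by move=> [p0 _]; exact: mulr_ge0. Qed.

Lemma tsallis_ge0 alpha p : 0 < alpha -> is_pmf p -> 0 <= tsallis alpha p.
Proof.
by move=> a0 pp; apply: mean_ge0 => i; rewrite bregman_ge0 ?density_ge0.
Qed.

Lemma tsallis_powR alpha p : alpha != 1 -> is_pmf p ->
  1 + (alpha - 1) * tsallis alpha p = mean (fun i => (M%:R * p i) `^ alpha).
Proof.
move=> a1 pp; rewrite /tsallis -meanZ.
have -> : mean (fun i => (alpha - 1) * bregman alpha (M%:R * p i)) =
   mean (fun i => (M%:R * p i) `^ alpha +
     ((- alpha) * (M%:R * p i) + (alpha - 1))).
  congr mean; apply/funext => i; rewrite /bregman (negPf a1).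
  rewrite mulrC divfK ?subr_eq0//; ring.
by rewrite meanD [X in _ + (_ + X)]meanD meanZ mean_density// mean_cst; ring.
Qed.

Lemma tsallis_dom alpha p : is_pmf p -> 0 <= 1 + (alpha - 1) * tsallis alpha p.
Proof.
move=> pp; have [->|a1] := eqVneq alpha 1; first by rewrite subrr mul0r addr0.
by rewrite tsallis_powR//; apply: mean_ge0 => i; exact: powR_ge0.
Qed.

(** If the quadratic bound holds at every point, it can be averaged. Otherwise a single exceptional
    point already contributes [m / M] to the mean, the other terms being nonnegative. *)
Lemma tsallis_dichotomy alpha k : 0 < alpha -> 1 < k ->
  exists2 m : R, 0 < m & forall p, is_pmf p ->
    alpha / 2 * chi2 p <= k * tsallis alpha p \/ m <= tsallis alpha p.
Proof.
move=> a0 k1; have [m m0 hm] := bregman_dichotomy a0 k1.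
exists (M%:R^-1 * m); first by rewrite mulr_gt0// invr_gt0.
move=> p pp.
have [/forallP H|/forallPn[i Hi]] := boolP [forall i,
    alpha / 2 * (M%:R * p i - 1) ^+ 2 <= k * bregman alpha (M%:R * p i)].
  by left; rewrite /chi2 /tsallis -!meanZ; exact: ler_mean.
right; have [h|h] := hm _ (density_ge0 i pp); first by rewrite h in Hi.
apply: le_trans (mean_ge_term i _) => [|j]; last first.
  by rewrite bregman_ge0 ?density_ge0.
by rewrite ler_wpM2l// invr_ge0 ltW.
Qed.

Lemma arimoto_ge0 alpha p : 0 < alpha -> is_pmf p -> 0 <= arimoto alpha p.
Proof.
have lt12 : 1 < 2 :> R by rewrite ltr1n.
move=> a0 pp; have [m m0 H] := arimoto_of_tsallis_dichotomy a0 lt12.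
have [h|h] := H _ (tsallis_ge0 a0 pp) (tsallis_dom alpha pp).
  by rewrite -(@pmulr_rge0 _ 2)// (le_trans _ h)// tsallis_ge0.
by rewrite (le_trans _ h)// ltW.
Qed.

(** Chaining the two dichotomies costs a factor [k] each; when the two scales are comparable, a
    Tsallis divergence above [m] still leaves [m / k]. *)
Lemma arimoto_dichotomy alpha k : 0 < alpha -> 1 < k ->
  exists2 m : R, 0 < m & forall p, is_pmf p ->
    alpha / 2 * chi2 p <= k ^+ 2 * arimoto alpha p \/ m <= arimoto alpha p.
Proof.
move=> a0 k1; have k0 : 0 < k by lra.
have [m m0 Hm] := tsallis_dichotomy a0 k1.
have [n n0 Hn] := arimoto_of_tsallis_dichotomy a0 k1.
exists (Num.min n (m / k)); first by rewrite lt_min n0 divr_gt0.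
move=> p pp.
have [h|h] := Hn _ (tsallis_ge0 a0 pp) (tsallis_dom alpha pp); last first.
  by right; rewrite ge_min h.
have [h'|h'] := Hm p pp.
  by left; rewrite (le_trans h')// expr2 -mulrA ler_pM2l.
by right; rewrite ge_min ler_pdivrMr// [_ * k]mulrC (le_trans h' h) orbT.
Qed.

Lemma arimotoE alpha p : 0 < alpha -> alpha != 1 -> is_pmf p ->
  arimoto alpha p = alpha / (alpha - 1) *
    (M%:R `^ ((alpha - 1) / alpha) * alpha_norm alpha p - 1).
Proof.
move=> a0 a1 pp; rewrite /arimoto /arimoto_of_tsallis (negPf a1).
congr (_ * (_ - _)); rewrite tsallis_powR// /alpha_norm powRrM.
rewrite -powRM ?powR_ge0 ?sumr_ge0//; last by move=> i _; exact: powR_ge0.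
congr (_ `^ _); rewrite /mean powRB ?MR_neq0 ?implybT//.
rewrite powRr1 ?ltW// -mulrA mulrCA; congr (_ * _).
rewrite mulr_sumr; apply: eq_bigr => i _.
by rewrite powRM ?(ltW MR0)//; case: pp.
Qed.

Lemma arimoto1E b p : 1 < b -> is_pmf p ->
  arimoto 1 p = ln b * (logb b M%:R - shannon_entropy b p).
Proof.
move=> b1 pp; have lb : ln b != 0 by rewrite gt_eqF// ln_gt0.
have [p0 p1] := pp.
rewrite /arimoto /arimoto_of_tsallis eqxx /tsallis.
have -> : mean (fun i => bregman 1 (M%:R * p i)) =
  mean (fun i => M%:R * (p i * ln M%:R + p i * ln (p i)) +
    ((- 1) * (M%:R * p i) + 1)).
  congr mean; apply/funext => i; rewrite /bregman eqxx.
  (* Points of mass zero are separate because the logarithm of the product does not split there;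
     both sides equal 1. *)
  have [->|pi0] := eqVneq (p i) 0; first by ring.
  by rewrite lnM ?posrE// ?lt0r ?pi0 ?p0//; ring.
rewrite meanD [X in _ + X]meanD !meanZ -[mean p]/(M%:R^-1 * _) p1 mean_cst.
rewrite mulr1 mulfV// mulr1 addNr addr0 /mean mulVKf// big_split/=.
rewrite -mulr_suml p1 mul1r /shannon_entropy /logb opprK mulrDr mulrCA.
rewrite mulfV// mulr1; congr (_ + _); rewrite mulr_sumr; apply: eq_bigr => i _.
by field.
Qed.

Lemma guessing_entropy_attained rho p :
  exists s : 'S_M, guessing_entropy rho p = guess_moment rho p s.
Proof.
rewrite /guessing_entropy; elim/big_ind: _ => [|x y [s ->] [s' ->]|s _].
- by exists 1%g.
- by rewrite minEle; case: ifP; [exists s|exists s'].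
- by exists s.
Qed.

Lemma uniform_guessingE rho : uniform_guessing rho M =
  mean (fun i => i.+1%:R `^ rho).
Proof. by []. Qed.

Lemma uniform_guessing_variance rho :
  uniform_guessing (2 * rho) M - uniform_guessing rho M ^+ 2 =
  mean (fun i => (i.+1%:R `^ rho - uniform_guessing rho M) ^+ 2).
Proof.
set G := uniform_guessing rho M.
have -> : mean (fun i => (i.+1%:R `^ rho - G) ^+ 2) =
  mean (fun i => i.+1%:R `^ (2 * rho) +
    ((- 2 * G) * i.+1%:R `^ rho + G ^+ 2)).
  congr mean; apply/funext => i.
  rewrite mulrC powRrM powR_mulrn ?powR_ge0//; ring.
rewrite meanD [X in _ = _ + X]meanD meanZ mean_cst -!uniform_guessingE -/G; ring.
Qed.

(** At an optimal permutation the gap is minus the covariance of the density with [i ^ rho];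
    weighted AM-GM splits it into [chi2], which is invariant under permutations, and a variance. *)
Lemma guessing_gap_le rho p t : is_pmf p -> 0 < t ->
  uniform_guessing rho M - guessing_entropy rho p <= t / 2 * chi2 p +
    (uniform_guessing (2 * rho) M - uniform_guessing rho M ^+ 2) / (2 * t).
Proof.
move=> pp t0; rewrite uniform_guessing_variance.
have [s ->] := guessing_entropy_attained rho p.
set G := uniform_guessing rho M.
have chi2E : chi2 p = mean (fun i => (M%:R * p (s i) - 1) ^+ 2).
  by rewrite /chi2 /mean (reindex_inj (@perm_inj _ s)).
have p1s : mean (fun i => M%:R * p (s i)) = 1.
  have := mean_density pp.
  by rewrite /mean (reindex_inj (@perm_inj _ s)).
(* Centering by [G] is free because [1 - M * p (s i)] has mean 0; it produces the variance instead
   of the second moment. *)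
have -> : G - guess_moment rho p s =
   mean (fun i => (1 - M%:R * p (s i)) * (i.+1%:R `^ rho - G)).
  have -> : mean (fun i => (1 - M%:R * p (s i)) * (i.+1%:R `^ rho - G)) =
    mean (fun i => i.+1%:R `^ rho + (- M%:R * (p (s i) * i.+1%:R `^ rho)
       + (G * (M%:R * p (s i)) + (- G)))).
    by congr mean; apply/funext => i; ring.
  rewrite meanD [X in _ = _ + X]meanD [X in _ = _ + (_ + X)]meanD !(meanZ G) p1s.
  rewrite mean_cst mulr1 subrr addr0 meanZ -uniform_guessingE -/G.
  by rewrite /mean mulrA mulNr mulfV// mulN1r.
rewrite chi2E -meanZ [X in _ + X]mulrC -meanZ -meanD; apply: ler_mean => i.
set x := M%:R * _; set w := _ - G.
rewrite -subr_ge0.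
suff -> : t / 2 * (x - 1) ^+ 2 + (2 * t)^-1 * w ^+ 2 - (1 - x) * w =
    (t * (x - 1) + w) ^+ 2 / (2 * t).
  by rewrite divr_ge0 ?sqr_ge0// mulr_ge0// ltW.
by field; rewrite gt_eqF.
Qed.

Lemma guess_moment_ge0 rho p s : is_pmf p -> 0 <= guess_moment rho p s.
Proof. by move=> [p0 _]; apply: sumr_ge0 => i _; rewrite mulr_ge0 ?powR_ge0. Qed.

Lemma uniform_guessing_ge0 rho : 0 <= uniform_guessing rho M :> R.
Proof. by apply: mean_ge0 => i; exact: powR_ge0. Qed.

Lemma guessing_gap_le_uniform rho p : is_pmf p ->
  uniform_guessing rho M - guessing_entropy rho p <= uniform_guessing rho M.
Proof.
move=> pp; have [s ->] := guessing_entropy_attained rho p.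
by rewrite gerBl guess_moment_ge0.
Qed.

(* The second alternative of [arimoto_dichotomy] only contributes the linear
   term [C * arimoto], which is of higher order than the square root. *)
Lemma guessing_gap_arimoto alpha rho k : 0 < alpha -> 1 < k ->
  exists2 C : R, 0 <= C & forall p t, is_pmf p -> 0 < t ->
    uniform_guessing rho M - guessing_entropy rho p <=
      (t * (k ^+ 2 / alpha) + C) * arimoto alpha p +
      (uniform_guessing (2 * rho) M - uniform_guessing rho M ^+ 2) / (2 * t).
Proof.
move=> a0 k1; have [m m0 Hm] := arimoto_dichotomy a0 k1.
pose G : R := uniform_guessing rho M.
have G0 : 0 <= G := uniform_guessing_ge0 rho.
have V0 : 0 <= uniform_guessing (2 * rho) M - G ^+ 2.
  by rewrite uniform_guessing_variance; apply: mean_ge0 => i; exact: sqr_ge0.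
(* Where the divergence is at least [m], the trivial bound [G] on the gap is at most [G / m] times
   the divergence. *)
exists (G / m); first by rewrite divr_ge0// ltW.
move=> p t pp t0; have D0 := arimoto_ge0 a0 pp; have [h|h] := Hm p pp.
  apply: (le_trans (guessing_gap_le rho pp t0)); rewrite lerD2r mulrDl.
  rewrite -[leLHS]addr0 lerD//; last by rewrite mulr_ge0// divr_ge0// ltW.
  have -> : t / 2 * chi2 p = t / alpha * (alpha / 2 * chi2 p).
    by field; rewrite gt_eqF.
  have -> : t * (k ^+ 2 / alpha) * arimoto alpha p =
    t / alpha * (k ^+ 2 * arimoto alpha p) by ring.
  by rewrite ler_wpM2l// divr_ge0// ltW.
apply: (le_trans (guessing_gap_le_uniform rho pp)).
rewrite -[leLHS]addr0 lerD//; last by rewrite divr_ge0// mulr_ge0// ltW.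
apply: (@le_trans _ _ (G / m * arimoto alpha p)).
  by rewrite mulrAC ler_pdivlMr// ler_wpM2l.
rewrite ler_wpM2r// lerDr; apply: mulr_ge0; first exact: ltW.
by rewrite divr_ge0 ?sqr_ge0// ltW.
Qed.

End divergence.

(** * Averaging over the law of [Y], and the link with the information advantage *)

Section expectation.
Context (d d' : measure_display) (Omega : measurableType d)
  (T : measurableType d') (R : realType) (P : probability Omega R).
Variable Y : {RV P >-> T}.
Implicit Types (f g : T -> R) (a c : R).

Local Notation Q := (distribution P Y).
Local Notation intg f := (Q.-integrable [set: T] (EFin \o f)).

Lemma EyE f : Ey Y f = Rintegral Q [set: T] f.
Proof. by rewrite /Ey unlock. Qed.

Lemma Ey_integrable f c : measurable_fun [set: T] f ->
  (forall y, `|f y| <= c) -> intg f.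
Proof.
move=> mf fc; apply: measurable_bounded_integrable => //.
  by apply: (le_lt_trans (probability_le1 _ _)) => //; exact: ltry.
exists c; split; first exact: num_real.
by move=> x cx y _; exact: (le_trans (fc y) (ltW cx)).
Qed.

Lemma Ey_integrable_cst c : intg (fun=> c).
Proof.
by apply: (@Ey_integrable _ `|c|) => //; exact: measurable_cst.
Qed.

Lemma Ey_cst c : Ey Y (fun=> c) = c.
Proof. rewrite EyE Rintegral_cst// [X in fine X](_ : _ = 1%E) ?mulr1//.
exact: probability_setT. Qed.

Lemma Ey_integrableD f g : intg f -> intg g -> intg (fun y => f y + g y).
Proof. by move=> If Ig; have := integrableD measurableT If Ig. Qed.

Lemma Ey_integrableZ a f : intg f -> intg (fun y => a * f y).
Proof. by move=> If; have := integrableZl measurableT a If. Qed.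

Lemma EyD f g : intg f -> intg g -> Ey Y (fun y => f y + g y) = Ey Y f + Ey Y g.
Proof. by move=> If Ig; rewrite !EyE RintegralD. Qed.

Lemma EyZ a f : intg f -> Ey Y (fun y => a * f y) = a * Ey Y f.
Proof. by move=> If; rewrite !EyE RintegralZl. Qed.

Lemma ler_Ey f g : intg f -> intg g -> (forall y, f y <= g y) ->
  Ey Y f <= Ey Y g.
Proof. by move=> If Ig fg; rewrite !EyE le_Rintegral// => y _; exact: fg. Qed.

Lemma Ey_ge0 f : (forall y, 0 <= f y) -> 0 <= Ey Y f.
Proof. by move=> f0; rewrite EyE Rintegral_ge0. Qed.

Section functionals.
Variables (M : nat) (p : T -> 'I_M -> R).
Hypothesis mp : forall i, measurable_fun [set: T] (fun y => p y i).
Hypothesis pp : forall y, is_pmf (p y).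

Lemma pmf_le1 y i : p y i <= 1.
Proof.
have [p0 <-] := pp y; rewrite (bigD1 i)//= lerDl.
by apply: sumr_ge0.
Qed.

Lemma integrable_guessing_entropy rho :
  intg (fun y => guessing_entropy rho (p y)).
Proof.
have mgm s : measurable_fun [set: T] (fun y => guess_moment rho (p y) s).
  by apply: measurable_sum => i; exact: measurable_funM.
apply: (@Ey_integrable _ (\sum_(i < M) i.+1%:R `^ rho)).
  rewrite /guessing_entropy; elim: (index_enum _) => [|s r IH].
    rewrite [X in measurable_fun _ X](_ : _ =
      (fun y => guess_moment rho (p y) 1%g)); first exact: mgm.
    by apply/funext => y; rewrite big_nil.
  rewrite [X in measurable_fun _ X](_ : _ = (fun y => guess_moment rho (p y) s)
    \min (fun y => \big[Order.min/guess_moment rho (p y) 1%g]_(s <- r)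
      guess_moment rho (p y) s)); first exact: measurable_minr.
  by apply/funext => y; rewrite big_cons.
move=> y; have [s ->] := guessing_entropy_attained rho (p y).
rewrite ger0_norm ?guess_moment_ge0//; apply: ler_sum => i _.
by rewrite ler_piMl ?powR_ge0 ?pmf_le1.
Qed.

Lemma integrable_alpha_norm alpha : 0 < alpha ->
  intg (fun y => alpha_norm alpha (p y)).
Proof.
move=> a0; apply: (@Ey_integrable _ (M%:R `^ alpha^-1)).
  apply: (measurableT_comp (f := @powR R ^~ alpha^-1)
    (g := fun y => \sum_(i < M) p y i `^ alpha)).
    exact: measurable_powR.
  apply: measurable_sum => i.
  exact: (measurableT_comp (f := @powR R ^~ alpha) (measurable_powR _)).
move=> y; rewrite ger0_norm ?powR_ge0// ge0_ler_powR ?nnegrE//.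
- by rewrite invr_ge0 ltW.
- by apply: sumr_ge0 => i _; exact: powR_ge0.
rewrite -[M in leRHS]card_ord -sum1_card natr_sum; apply: ler_sum => i _.
have [p0 _] := pp y.
have -> : 1%:R = 1 `^ alpha :> R by rewrite powR1.
by rewrite ge0_ler_powR ?nnegrE ?pmf_le1// ltW.
Qed.

Lemma integrable_shannon_entropy b : 1 < b ->
  intg (fun y => shannon_entropy b (p y)).
Proof.
move=> b1; have lb := ln_gt0 b1.
apply: (@Ey_integrable _ (\sum_(i < M) (ln b)^-1)).
  rewrite /shannon_entropy; apply: measurableT_comp => //.
  apply: measurable_sum => i; apply: measurable_funM => //.
  rewrite /logb; apply: measurable_funM => //.
  exact: (measurableT_comp (@measurable_ln R)).
move=> y; rewrite /shannon_entropy normrN (le_trans (ler_norm_sum _ _ _))//.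
apply: ler_sum => i _; have [p0 _] := pp y.
rewrite /logb mulrA normrM (gtr0_norm (_ : 0 < (ln b)^-1)) ?invr_gt0//.
rewrite ler_piMl ?invr_ge0 ?(ltW lb)//.
have := p0 i; rewrite le_eqVlt => /predU1P[<-|q0]; first by rewrite mul0r normr0.
rewrite ler0_norm ?mulr_ge0_le0 ?ln_le0 ?pmf_le1//.
rewrite -mulrN -lnV ?posrE//.
(* Writing [q] for the mass, division by [q] turns [- q ln q <= 1] into [ln (1 / q) <= 1 / q]. *)
rewrite -(ler_pM2l (_ : 0 < (p y i)^-1)) ?invr_gt0//.
rewrite mulKf ?gt_eqF// mulr1 ltW// ln_sublinear// invr_gt0//.
Qed.

Hypothesis M0 : (0 < M)%N.

Lemma alpha_norm_ge1 alpha y : 0 < alpha -> alpha <= 1 ->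
  1 <= alpha_norm alpha (p y).
Proof.
move=> a0 a1; have [p0 p1] := pp y.
have <- : 1 `^ alpha^-1 = 1 :> R by rewrite powR1.
rewrite ge0_ler_powR ?nnegrE ?invr_ge0 ?(ltW a0)//.
  by apply: sumr_ge0 => i _; exact: powR_ge0.
rewrite -p1; apply: ler_sum => i _.
have := p0 i; rewrite le_eqVlt => /predU1P[<-|q0]; first exact: powR_ge0.
by rewrite ger1_powR// q0 pmf_le1.
Qed.

Lemma integrable_arimoto alpha : 0 < alpha ->
  intg (fun y => arimoto alpha (p y)).
Proof.
move=> a0; have [->|a1] := eqVneq alpha 1.
  (* Any base above 1 would do, since [arimoto 1] is free of the base. *)
  have b1 : 1 < 2 :> R by rewrite ltr1n.
  under eq_fun do rewrite (arimoto1E M0 b1)// mulrDr mulrN -mulNr.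
  apply: Ey_integrableD; first exact: Ey_integrable_cst.
  exact/Ey_integrableZ/integrable_shannon_entropy.
under eq_fun do rewrite (arimotoE M0)//.
apply: Ey_integrableZ; apply: Ey_integrableD; last exact: Ey_integrable_cst.
exact/Ey_integrableZ/integrable_alpha_norm.
Qed.

Lemma Ey_arimoto1 b : 1 < b ->
  Ey Y (fun y => arimoto 1 (p y)) = ln b * information_advantage Y p b 1.
Proof.
move=> b1; under eq_fun do rewrite (arimoto1E M0 b1)// mulrDr mulrN -mulNr.
rewrite EyD ?Ey_cst; [|exact: Ey_integrable_cst|
  exact/Ey_integrableZ/integrable_shannon_entropy].
rewrite EyZ; last exact: integrable_shannon_entropy.
by rewrite /information_advantage /cond_renyi_arimoto eqxx mulrBr mulNr.
Qed.

(* [M^((alpha-1)/alpha)] is the inverse of the norm of the uniform pmf. *)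
Let n alpha : R :=
  M%:R `^ ((alpha - 1) / alpha) * Ey Y (fun y => alpha_norm alpha (p y)).

Lemma Ey_arimoto alpha : 0 < alpha -> alpha != 1 ->
  Ey Y (fun y => arimoto alpha (p y)) = alpha / (alpha - 1) * (n alpha - 1).
Proof.
move=> a0 a1; under eq_fun do rewrite (arimotoE M0)//.
have Ia := integrable_alpha_norm a0.
rewrite EyZ; last first.
  by apply: Ey_integrableD; [exact: Ey_integrableZ|exact: Ey_integrable_cst].
by rewrite EyD ?Ey_cst ?EyZ//; [exact: Ey_integrableZ|exact: Ey_integrable_cst].
Qed.

Lemma Ey_arimoto_ge0 alpha : 0 < alpha ->
  0 <= Ey Y (fun y => arimoto alpha (p y)).
Proof. by move=> a0; apply: Ey_ge0 => y; exact: arimoto_ge0. Qed.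

(** Positivity lets [ln (n alpha)] split. Below 1 it comes from [alpha_norm_ge1]; above 1,
    nonnegativity of the averaged divergence even gives [n alpha >= 1]. *)
Lemma normalized_norm_gt0 alpha : 0 < alpha -> alpha != 1 -> 0 < n alpha.
Proof.
move=> a0 a1; have [al1|al1] := leP alpha 1.
  rewrite mulr_gt0 ?powR_gt0 ?ltr0n// (@lt_le_trans _ _ 1)//.
  rewrite -(Ey_cst 1); apply: ler_Ey; first exact: Ey_integrable_cst.
    exact: integrable_alpha_norm.
  by move=> y; exact: alpha_norm_ge1.
have := Ey_arimoto_ge0 a0; rewrite Ey_arimoto// pmulr_rge0 ?divr_gt0 ?subr_gt0//.
by rewrite subr_ge0; exact: lt_le_trans.
Qed.

(** With [Ey_arimoto], this reduces comparing the averaged divergence with the information advantage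
    to comparing [x - 1] with [ln x] at [x = n alpha]. *)
Lemma information_advantageE b alpha : 1 < b -> 0 < alpha -> alpha != 1 ->
  ln b * information_advantage Y p b alpha = alpha / (alpha - 1) * ln (n alpha).
Proof.
move=> b1 a0 a1; have n0 := normalized_norm_gt0 a0 a1.
have lb : ln b != 0 by rewrite gt_eqF// ln_gt0.
have MR0 : 0 < M%:R :> R by rewrite ltr0n.
rewrite /information_advantage /cond_renyi_arimoto (negPf a1) /n.
have c0 : 0 < M%:R `^ ((alpha - 1) / alpha) :> R by rewrite powR_gt0.
rewrite lnM ?posrE//; last by move: n0; rewrite /n pmulr_rgt0.
rewrite ln_powR /logb; set N := Ey _ _.
by field; rewrite lb subr_eq0 a1 gt_eqF.
Qed.

End functionals.
End expectation.

(* Jensen's inequality gives [Ey arimoto <= ln b * information_advantage] for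
   [alpha <= 1]; for [alpha > 1] it goes the wrong way and only holds up to a
   factor tending to 1. *)
Lemma Ey_arimoto_le (R : realType) (b : R) (M : nat) (alpha k : R) :
  1 < b -> (0 < M)%N -> 0 < alpha -> 1 < k ->
  exists2 delta : R, 0 < delta &
  forall (d d' : measure_display) (Omega : measurableType d)
    (T : measurableType d') (P : probability Omega R)
    (Y : {RV P >-> T}) (p : T -> 'I_M -> R),
  (forall i, measurable_fun [set: T] (fun y => p y i)) ->
  (forall y, is_pmf (p y)) ->
  information_advantage Y p b alpha <= delta ->
  Ey Y (fun y => arimoto alpha (p y)) <=
    k * (ln b * information_advantage Y p b alpha).
Proof.
move=> b1 M0 a0 k1; have lb := ln_gt0 b1; have k0 : 0 < k by lra.
have lek (x h : R) : 0 <= x -> x <= h -> x <= k * h.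
  by move=> x0 xh; rewrite (le_trans xh)// ler_peMl ?(le_trans x0)// ltW.
have [->|a1] := eqVneq alpha 1.
  exists 1 => // d d' Omega T P Y p mp pp _; apply: lek.
    exact: Ey_arimoto_ge0.
  by rewrite (Ey_arimoto1 Y mp pp M0 b1).
have [al1|al1] := leP alpha 1.
  exists 1 => // d d' Omega T P Y p mp pp _; apply: lek.
    exact: Ey_arimoto_ge0.
  have n0 := normalized_norm_gt0 Y mp pp M0 a0 a1.
  rewrite information_advantageE// Ey_arimoto//.
  set x := (X in 0 < X) in n0 *.
  (* The factor [alpha / (alpha - 1)] is negative here, so this inequality gets reversed. *)
  have lx : ln x <= x - 1.
    by have := @le_ln1Dx R (x - 1); rewrite subrKC; apply; lra.
  rewrite ler_wnM2l// mulr_ge0_le0 ?(ltW a0)// invr_le0 subr_le0 //.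
(* This threshold forces [ln x <= ln k], after which [x - 1 <= x * ln x <= k * ln x]. *)
exists (alpha / (alpha - 1) * ln k / ln b).
  by rewrite !(divr_gt0, mulr_gt0)// ?ln_gt0// subr_gt0.
move=> d d' Omega T P Y p mp pp; rewrite ler_pdivlMr// [_ * ln b]mulrC.
have n0 := normalized_norm_gt0 Y mp pp M0 a0 a1.
have := Ey_arimoto_ge0 Y pp M0 a0.
rewrite information_advantageE// Ey_arimoto//.
set x := (X in 0 < X) in n0 *.
have c0 : 0 < alpha / (alpha - 1) by rewrite divr_gt0// subr_gt0.
rewrite pmulr_rge0// subr_ge0 => x1.
rewrite ler_pM2l// ler_ln ?posrE// => xk.
rewrite mulrCA ler_pM2l//.
have lx : x - 1 <= x * ln x.
  have : - ln x <= x^-1 - 1.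
    have := @le_ln1Dx R (x^-1 - 1); rewrite subrKC lnV ?posrE//; apply.
    by rewrite ltrBrDr addNr invr_gt0.
  rewrite -(ler_pM2l n0) mulrBr mulfV ?gt_eqF//; lra.
by rewrite (le_trans lx)// ler_wpM2r// ln_ge0.
Qed.

(** * Optimization over [t] and choice of the small parameters *)

Lemma le_sqrt_of_AMGM (R : rcfType) (e a v r : R) : 0 <= a -> 0 <= v ->
  (forall t, 0 < t -> e <= t * a / 2 + v / (2 * t) + r) ->
  e <= Num.sqrt (a * v) + r.
Proof.
move=> a0 v0 H; rewrite sqrtrM//.
set A := Num.sqrt a; set B := Num.sqrt v.
have A0 : 0 <= A := sqrtr_ge0 a.
have B0 : 0 <= B := sqrtr_ge0 v.
have aE : a = A ^+ 2 by rewrite sqr_sqrtr.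
have vE : v = B ^+ 2 by rewrite sqr_sqrtr.
apply/ler_addgt0Pr => x x0.
pose y := x / (A + B + 1).
have AB1 : 0 < A + B + 1 by lra.
have y0 : 0 < y by rewrite divr_gt0.
have By : 0 < B + y by lra.
have Ay : 0 < A + y by lra.
(* The ideal choice [B / A] degenerates when a root vanishes; shifting both by [y] keeps it positive
   and costs at most [x]. *)
have := H ((B + y) / (A + y)); rewrite divr_gt0// => /(_ isT) h.
have h1 : (B + y) / (A + y) * a / 2 <= (B + y) * A / 2.
  rewrite ler_wpM2r// aE expr2 mulrA ler_wpM2r//.
  rewrite mulrAC ler_pdivrMr// ler_wpM2l//; lra.
have h2 : v / (2 * ((B + y) / (A + y))) <= (A + y) * B / 2.
  have -> : v / (2 * ((B + y) / (A + y))) = (A + y) * B / 2 * (B / (B + y)).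
    by rewrite vE; field; rewrite !gt_eqF.
  rewrite ler_piMr ?divr_ge0 ?mulr_ge0 ?(ltW Ay)//.
  by rewrite ler_pdivrMr// mul1r lerDl ltW.
have : y * (A + B + 1) = x by rewrite divfK ?gt_eqF.
nra.
Qed.

Lemma guessing_advantage_first_order (R : realType) (b : R) (M : nat)
    (rho alpha : R) : 1 < b -> (0 < M)%N -> 0 < alpha ->
  first_order_bound b M rho alpha
    (Num.sqrt (2 * (uniform_guessing (2 * rho) M
                    - uniform_guessing rho M ^+ 2) / alpha)).
Proof.
move=> b1 M0 a0 eps e0; have lb := ln_gt0 b1.
set V := uniform_guessing (2 * rho) M - uniform_guessing rho M ^+ 2.
have V0 : 0 <= V.
  rewrite /V uniform_guessing_variance//; apply: mean_ge0 => // i.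
  exact: sqr_ge0.
set c := Num.sqrt _; have c0 : 0 <= c := sqrtr_ge0 _.
(* Chosen so that [(1 + th) ^ 2 * c <= c + 3 * th * c <= c + eps / 2]; the [+ 1] avoids division by
   zero. *)
pose th := Num.min 1 (eps / (6 * (c + 1))).
have th0 : 0 < th by rewrite lt_min ltr01/= divr_gt0// mulr_gt0//; lra.
have th1 : th <= 1 by rewrite ge_min lexx.
have thc : th * c <= eps / 6.
  have : th * (c + 1) <= eps / 6.
    rewrite -ler_pdivlMr; last lra.
    by rewrite -mulrA -invfM ge_min lexx orbT.
  nra.
pose k := 1 + th.
have k1 : 1 < k by rewrite /k; lra.
have k0 : 0 < k by lra.
have kc : k ^+ 2 * c <= c + eps / 2 by rewrite /k; nra.
have [C C0 HC] := guessing_gap_arimoto M0 rho a0 k1.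
have [delta1 d10 Hd] := Ey_arimoto_le b1 M0 a0 k1.
(* An upper bound for the root of the information advantage in nats, making the linear term
   [C * k * h] at most [eps / 2] times that root. *)
pose q := eps / (2 * (C * k + 1)).
have Ck : 0 <= C * k by rewrite mulr_ge0// ltW.
have q0 : 0 < q by rewrite divr_gt0// mulr_gt0//; lra.
exists (Num.min delta1 (q ^+ 2 / ln b)).
  by rewrite lt_min d10 divr_gt0// exprn_gt0.
move=> d d' Omega T P X Y p _ [mp pp _]; rewrite le_min => /andP[h1 h2].
set I := information_advantage Y p b alpha in h1 h2 *.
have -> : I / logb b (expR 1) = ln b * I.
  by rewrite /logb expRK invf_div divr1 mulrC.
set h := ln b * I.
have hq : h <= q ^+ 2 by move: h2; rewrite ler_pdivlMr// mulrC.
have {Hd}EA := Hd _ _ _ _ _ Y p mp pp h1.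
have EA0 := Ey_arimoto_ge0 Y pp M0 a0.
rewrite -/I -/h in EA.
(* The information advantage is nonnegative because [k * h] dominates the average of a nonnegative
   divergence. *)
have h0 : 0 <= h by rewrite -(pmulr_rge0 _ k0) (le_trans EA0).
have Ig := integrable_guessing_entropy Y mp pp rho.
have Ia := integrable_arimoto Y mp pp M0 a0.
(* In [k ^+ 3], two factors come from the pointwise bound and one from averaging. *)
have gap t : 0 < t -> guessing_advantage Y p rho <=
    t * (2 * k ^+ 3 / alpha * h) / 2 + V / (2 * t) + C * k * h.
  move=> t0.
  have -> : guessing_advantage Y p rho =
      Ey Y (fun y => uniform_guessing rho M + (-1) * guessing_entropy rho (p y)).
    rewrite EyD; [|exact: Ey_integrable_cst|exact: Ey_integrableZ].
    by rewrite Ey_cst EyZ// mulN1r.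
  apply: (@le_trans _ _ (Ey Y (fun y =>
      (t * (k ^+ 2 / alpha) + C) * arimoto alpha (p y) + V / (2 * t)))).
    apply: ler_Ey.
    - by apply: Ey_integrableD; [exact: Ey_integrable_cst|exact: Ey_integrableZ].
    - by apply: Ey_integrableD; [exact: Ey_integrableZ|exact: Ey_integrable_cst].
    - by move=> y; rewrite mulN1r; exact: HC.
  rewrite EyD; [|exact: Ey_integrableZ|exact: Ey_integrable_cst].
  rewrite Ey_cst EyZ//.
  have -> : t * (2 * k ^+ 3 / alpha * h) / 2 + V / (2 * t) + C * k * h =
    (t * (k ^+ 2 / alpha) + C) * (k * h) + V / (2 * t).
    by field; rewrite !gt_eqF.
  rewrite lerD2r ler_wpM2l// addr_ge0//.
  by rewrite mulr_ge0 ?(ltW t0)// divr_ge0 ?sqr_ge0 ?(ltW a0).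
apply: (le_trans (le_sqrt_of_AMGM _ V0 gap)).
  by rewrite mulr_ge0// !(divr_ge0, mulr_ge0)// ?exprn_ge0 ltW.
set s := Num.sqrt h; have s0 : 0 <= s := sqrtr_ge0 h.
have hE : h = s ^+ 2 by rewrite sqr_sqrtr.
have sq : s <= q by rewrite -(@ler_pXn2r _ 2) ?nnegrE ?(ltW q0)// -hE.
have Va0 : 0 <= 2 * V / alpha.
  by apply: divr_ge0; [exact: mulr_ge0|exact: ltW].
(* Rounding [k ^+ 3] up to [k ^+ 4] lets [k ^+ 2] leave the square root. *)
have main : Num.sqrt (2 * k ^+ 3 / alpha * h * V) <= k ^+ 2 * c * s.
  have -> : k ^+ 2 * c * s = Num.sqrt ((k ^+ 2) ^+ 2 * (2 * V / alpha) * h).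
    rewrite sqrtrM; last by apply: mulr_ge0 => //; exact: sqr_ge0.
    by rewrite sqrtrM ?sqr_ge0// sqrtr_sqr ger0_norm// sqr_ge0.
  apply: ler_wsqrtr.
  have -> : 2 * k ^+ 3 / alpha * h * V = k ^+ 3 * (2 * V / alpha * h).
    by field; rewrite gt_eqF.
  rewrite -[leRHS]mulrA ler_wpM2r//; first exact: mulr_ge0.
  by rewrite -exprM ler_weXn2l// ltW.
have lin : C * k * h <= eps / 2 * s.
  rewrite hE expr2 mulrA ler_wpM2r//.
  apply: (@le_trans _ _ (C * k * q)); first by rewrite ler_wpM2l.
  have : (C * k + 1) * q = eps / 2 by rewrite /q; field; rewrite gt_eqF; lra.
  nra.
have : k ^+ 2 * c * s <= (c + eps / 2) * s by rewrite ler_wpM2r.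
lra.
Qed.

(** * The variance for [rho = 1], and the two bounds *)

Lemma uniform_guessing1_variance (R : realType) (M : nat) : (0 < M)%N ->
  uniform_guessing (2 * 1) M - uniform_guessing 1 M ^+ 2 =
  (M%:R ^+ 2 - 1) / 12 :> R.
Proof.
move=> M0; have M1 : M%:R != 0 :> R by rewrite pnatr_eq0 -lt0n.
have s1 m : \sum_(i < m) i.+1%:R = m%:R * (m%:R + 1) / 2 :> R.
  elim: m => [|m IH]; first by rewrite big_ord0 !mul0r.
  by rewrite big_ord_recr/= IH -natr1; field.
have s2 m : \sum_(i < m) i.+1%:R ^+ 2 =
    m%:R * (m%:R + 1) * (2 * m%:R + 1) / 6 :> R.
  elim: m => [|m IH]; first by rewrite big_ord0 !mul0r.
  by rewrite big_ord_recr/= IH -natr1; field.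
rewrite /uniform_guessing mulr1.
under eq_bigr do rewrite powR_mulrn//.
under [in X in _ - X]eq_bigr do rewrite powRr1//.
by rewrite s1 s2; field.
Qed.

Theorem corollary1 (R : realType) (b : R) (hb : 1 < b)
    (M : nat) (hM : (2 <= M)%N) (rho alpha : R)
    (hrho : 0 < rho) (halpha : 0 < alpha) :
  first_order_bound b M rho alpha
    (Num.sqrt (2 * (uniform_guessing (2 * rho) M
                    - uniform_guessing rho M ^+ 2) / alpha))
  /\
  first_order_bound b M 1 alpha
    (Num.sqrt ((M%:R ^+ 2 - 1) / (6 * alpha))).
Proof.
have M0 : (0 < M)%N by exact: ltn_trans hM.
split; first exact: guessing_advantage_first_order.
have -> : (M%:R ^+ 2 - 1) / (6 * alpha) = 2 * (uniform_guessing (2 * 1) M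
    - uniform_guessing 1 M ^+ 2) / alpha :> R.
  by rewrite uniform_guessing1_variance//; field; rewrite gt_eqF.
exact: guessing_advantage_first_order.
Qed.
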